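(* Let $p,n\in\mathbb N$ with $p\ge n\ge 15$ and $p=k(n-1)+n-7$ for some $k\in\mathbb N$. Then $$\mathrm{ex}(p;T_n^3)=\frac{(n-2)p-6(n-7)}2+\max\Big\{\Big\lfloor\frac{n-37}4\Big\rfloor,0\Big\}.$$
   Context: All graphs are finite simple graphs. For a graph $L$, $\mathrm{ex}(p;L)$ denotes the maximum number of edges in a graph on $p$ vertices that contains no subgraph isomorphic to $L$. For $n\ge 6$, $T_n^3$ is the tree on vertex set $\{v_0,\ldots,v_{n-1}\}$ with edge set $\{v_0v_1,v_0v_2,\ldots,v_0v_{n-4},\ v_1v_{n-3},\ v_1v_{n-2},\ v_1v_{n-1}\}$. $\lfloor x\rfloor$ is the greatest integer not exceeding $x$; $\mathbb N=\{1,2,\ldots\}$. *)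

(* Defs.v *)
From mathcomp Require Import all_boot.
Set Implicit Arguments. Unset Strict Implicit. Unset Printing Implicit Defensive.

Definition simple_graph (p : nat) (G : {set {set 'I_p}}) : bool :=
  [forall e in G, #|e| == 2].

Definition contains_sub (m p : nat) (L : {set {set 'I_m}})
    (G : {set {set 'I_p}}) : bool :=
  [exists f : {ffun 'I_m -> 'I_p},
     injectiveb f && [forall e in L, (f @: e) \in G]].

Definition ex (p m : nat) (L : {set {set 'I_m}}) : nat :=
  \max_(G : {set {set 'I_p}} | simple_graph G && ~~ contains_sub L G) #|G|.

Definition T3_adj (n : nat) (i j : 'I_n) : bool :=
  ((val i == 0) && (1 <= val j <= n - 4)) ||
  ((val i == 1) && (n - 3 <= val j <= n - 1)).

Definition T3 (n : nat) : {set {set 'I_n}} :=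
  [set e | [exists i : 'I_n, exists j : 'I_n, (e == [set i; j]) && T3_adj i j]].

(* Main.v *)
Require Import Defs.
From mathcomp Require Import all_boot.
From mathcomp Require Import ssralg finalg zmodp.
From mathcomp Require Import zify.
Set Implicit Arguments. Unset Strict Implicit. Unset Printing Implicit Defensive.

(* [T3 n] is a double star, so a graph avoids it iff every edge vw with
   d(v) >= n - 4 and d(w) >= 4 satisfies |N(v) U N(w)| <= n - 1; this condition
   passes to induced subgraphs.  For the upper bound, consider the deficiency
   (n - 2)|S| - sum of degrees of induced subgraphs on vertex sets S with
   |S| = -j (mod n - 1) and j <= 6.  If v has degree at least n - 3, then only
   few edges leave N[v], and deleting N[v] (sometimes with one further vertex)
   reduces |S| without losing deficiency.  If all degrees are at most n - 4, the
   deficiency is at least 2|S|, which leaves only |S| = 2(n - 1) - j with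
   j = 5, 6.  There, for v of degree n - 4, the set N[v] and its complement B
   have about n vertices each, and a vertex of degree n - 4 in N[v] usually has
   no neighbour in B: many such vertices leave B with too few edges, few of
   them leave most degrees at n - 5.
   The lower bound is attained by disjoint cliques, one of them K_(n-7), or, for
   n >= 37, by disjoint K_(n-1) and the graph [exc_rel] on 2n - 8 vertices. *)

(* Removes truncated subtractions after the substitution n = m + 15, so that
   [lia] sees polynomial identities. *)
Lemma shift_sub m :
  (m + 15 - 1 = m + 14) * (m + 15 - 2 = m + 13) * (m + 15 - 3 = m + 12) *
  (m + 15 - 4 = m + 11) * (m + 15 - 5 = m + 10) * (m + 15 - 6 = m + 9) *
  (m + 15 + 1 - 5 = m + 11) * (m + 15 + 1 - 6 = m + 10) *
  (2 * (m + 15) - 2 - 5 = 2 * m + 23) * (2 * (m + 15) - 2 - 6 = 2 * m + 22) *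
  (2 * (m + 15) - 8 = 2 * m + 22).
Proof. by do !split; lia. Qed.

(** * Degree sums of induced subgraphs *)

Section Degrees.

Variables (V : finType) (e : rel V).
Implicit Types (A B S : {set V}) (v w x y : V).
Hypotheses (e_sym : symmetric e) (e_irr : irreflexive e).

Definition nbr (S : {set V}) (x : V) : {set V} := [set y in S | e x y].

(** Ordered pairs are counted, so [vol S S] is twice the number of edges inside [S]. *)
Definition vol (A B : {set V}) : nat := \sum_(x in A) #|nbr B x|.

Lemma in_nbr S x y : (y \in nbr S x) = (y \in S) && e x y.
Proof. by rewrite inE. Qed.

Lemma nbr_sub S x : nbr S x \subset S.
Proof. by apply/subsetP => y; rewrite in_nbr => /andP[]. Qed.

Lemma nbrS A B x : A \subset B -> nbr A x \subset nbr B x.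
Proof.
by move=> /subsetP sAB; apply/subsetP => y; rewrite !in_nbr => /andP[/sAB-> ->].
Qed.

Lemma nbrID S A x :
  A \subset S -> #|nbr S x| = #|nbr A x| + #|nbr (S :\: A) x|.
Proof.
move=> /subsetP sAS; rewrite -(cardsID A (nbr S x)); congr (_ + _);
  apply: eq_card => y; rewrite !inE.
- by case: (boolP (y \in A)) => [/sAS->|]; rewrite ?andbT ?andbF.
- by case: (y \in A); rewrite ?andbT ?andbF.
Qed.

Lemma volC A B : vol A B = vol B A.
Proof.
have E C D : vol C D = \sum_(x in C) \sum_(y in D) e x y.
  apply: eq_bigr => x _; rewrite -sum1_card big_mkcond [RHS]big_mkcond /=.
  by apply: eq_bigr => y _; rewrite in_nbr; case: (y \in D); case: (e x y).
rewrite !E exchange_big /=; apply: eq_bigr => x _; apply: eq_bigr => y _.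
by rewrite e_sym.
Qed.

Lemma volDl S A B : A \subset S -> vol S B = vol A B + vol (S :\: A) B.
Proof. by move=> /setIidPr sAS; rewrite /vol (big_setID A) /= sAS. Qed.

(** By symmetry the edges between [A] and the rest can all be charged to [A]: each of its vertices
    pays its degree plus its number of neighbours outside [A]. *)
Lemma vol_remove S A : A \subset S ->
  vol S S = \sum_(x in A) (#|nbr S x| + #|nbr (S :\: A) x|)
            + vol (S :\: A) (S :\: A).
Proof.
move=> sAS; rewrite (volDl _ sAS) big_split /= -/(vol A S) -/(vol A (S :\: A)).
by rewrite -addnA (volC A (S :\: A)) {2 3}/vol -big_split /=;
   congr (_ + _); apply: eq_bigr => x _; rewrite (nbrID _ sAS).
Qed.

Lemma leq_sum_card A (F : V -> nat) c :
  (forall x, x \in A -> F x <= c) -> \sum_(x in A) F x <= c * #|A|.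
Proof. by move=> H; rewrite mulnC -sum_nat_const; apply: leq_sum. Qed.

Lemma vol_clique S : vol S S <= #|S|.-1 * #|S|.
Proof.
apply: leq_sum_card => x xS.
have: nbr S x \subset S :\ x.
  apply/subsetP => y; rewrite !inE => /andP[-> exy]; rewrite andbT.
  by apply: contraTneq exy => ->; rewrite e_irr.
by move/subset_leq_card; rewrite (cardsD1 x S) xS.
Qed.

Lemma vol_remove1 S b : b \in S ->
  vol S S = 2 * #|nbr S b| + vol (S :\ b) (S :\ b).
Proof.
move=> bS; rewrite (@vol_remove S [set b]) ?sub1set // big_set1.
have := @nbrID S [set b] b; rewrite sub1set => /(_ bS) ->.
suff -> : #|nbr [set b] b| = 0 by lia.
apply/eqP; rewrite cards_eq0 -subset0; apply/subsetP => y.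
by rewrite !inE => /andP[/eqP->]; rewrite e_irr.
Qed.

(** * Local consequences of excluding the double star *)

Definition tfree (n : nat) := forall v w, e v w ->
  n - 4 <= #|nbr setT v| -> 4 <= #|nbr setT w| ->
  #|nbr setT v :|: nbr setT w| <= n - 1.

Variable n : nat.
Hypotheses (n_ge15 : 15 <= n) (e_tfree : tfree n).

Definition cnbr S v := v |: nbr S v.

Lemma cnbr_sub S v : v \in S -> cnbr S v \subset S.
Proof. by move=> vS; rewrite subUset sub1set vS nbr_sub. Qed.

Lemma card_cnbr S v : #|cnbr S v| = #|nbr S v|.+1.
Proof. by rewrite cardsU1 in_nbr e_irr andbF. Qed.

Lemma nbr_out_self S v : #|nbr (S :\: cnbr S v) v| = 0.
Proof.
apply/eqP; rewrite cards_eq0 -subset0; apply/subsetP => y.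
by rewrite !inE; case: (e v y); rewrite ?andbT ?andbF //; case: (y \in S);
   rewrite ?orbT ?andbF.
Qed.

Lemma nbr_out_lt S v w : w \in nbr S v -> v \in S ->
  #|nbr (S :\: cnbr S v) w| < #|nbr S w|.
Proof.
rewrite in_nbr => /andP[wS evw] vS; rewrite (nbrID w (cnbr_sub vS)).
rewrite -addn1 addnC leq_add2r card_gt0; apply/set0Pn; exists v.
by rewrite !inE eqxx e_sym evw.
Qed.

(** Degrees only grow from [S] to [setT], so [tfree] applies. The union of the two neighbourhoods
    contains three disjoint sets: N_S(v), the vertex [v], and the neighbours of [w] in [S] outside
    N_S[v]. *)
Lemma tfree_nbr S v w : v \in S -> w \in nbr S v -> n - 4 <= #|nbr S v| ->
  #|nbr S w| <= 3 \/ #|nbr S v| + #|nbr (S :\: cnbr S v) w| <= n - 2.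
Proof.
move=> vS wN dv; have [dw|dw] := leqP #|nbr S w| 3; [by left|right].
have evw : e v w by move: wN; rewrite in_nbr => /andP[].
have mono x : #|nbr S x| <= #|nbr setT x|
  by apply/subset_leq_card/nbrS/subsetT.
have := e_tfree evw (leq_trans dv (mono v)) (leq_trans dw (mono w)).
set B := S :\: _.
have disj : [disjoint nbr S v & v |: nbr B w].
  rewrite disjoint_subset; apply/subsetP => y; rewrite !inE => /andP[yS evy].
  rewrite yS evy orbT /= orbF; apply: contraTneq evy => ->.
  by rewrite e_irr.
have: nbr S v :|: (v |: nbr B w) \subset nbr setT v :|: nbr setT w.
  apply/subsetP => y; rewrite !inE /= => /orP[/andP[_ ->]//|/orP[/eqP->|/andP[_ ->]]].
  - by rewrite e_sym in evw; rewrite evw orbT.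
  - by rewrite orbT.
move/subset_leq_card; rewrite cardsU disjoint_setI0 // cards0 subn0 cardsU1.
have -> : v \notin nbr B w by rewrite !inE eqxx.
lia.
Qed.

Lemma full_out_le2 S v w : v \in S -> #|nbr S v| = n - 4 -> w \in nbr S v ->
  #|nbr (S :\: cnbr S v) w| <= 2.
Proof.
move=> vS dv wN.
by have := nbr_out_lt wN vS; have := tfree_nbr vS wN; rewrite dv; lia.
Qed.

Lemma vol_remove_cnbr S v c : v \in S ->
  (forall w, w \in nbr S v ->
    #|nbr S w| + #|nbr (S :\: cnbr S v) w| <= c) ->
  vol S S <= #|nbr S v| + c * #|nbr S v| +
             vol (S :\: cnbr S v) (S :\: cnbr S v).
Proof.
move=> vS H; rewrite (vol_remove (cnbr_sub vS)) leq_add2r big_setU1 /=;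
  last by rewrite in_nbr e_irr andbF.
by rewrite nbr_out_self addn0 leq_add2l; apply: leq_sum_card.
Qed.

Lemma card_out S v : v \in S -> #|S :\: cnbr S v| + #|nbr S v|.+1 = #|S|.
Proof.
move=> vS; rewrite cardsD; have /setIidPr -> := cnbr_sub vS.
have := subset_leq_card (cnbr_sub vS); rewrite card_cnbr; lia.
Qed.

(** The second alternative of [tfree_nbr] is impossible, so every neighbour of [v] has degree at
    most 3 in [S], with [v] among its neighbours, and pays at most 3 + 2. The degree of [v] adds one
    more per neighbour. *)
Lemma vol_huge S v : v \in S -> n - 1 <= #|nbr S v| ->
  vol S S <= 6 * #|nbr S v| + vol (S :\: cnbr S v) (S :\: cnbr S v).
Proof.
move=> vS dv; apply: (leq_trans (@vol_remove_cnbr S v 5 vS _)); last by lia.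
move=> w wN; have := nbr_out_lt wN vS.
by have [] := tfree_nbr vS wN; lia.
Qed.

(** Deleting the closed neighbourhood of a vertex of degree at least n - 1 costs less than 6 per
    vertex, below the n - 2 allowed. Without such a vertex all degrees are at most n - 2. *)
Lemma vol_le S : vol S S <= (n - 2) * #|S|.
Proof.
have [m] := ubnP #|S|; elim: m S => // m IH S ltS.
case: (boolP [exists v in S, n - 1 <= #|nbr S v|]); last first.
  move=> /exists_inPn H; apply: leq_sum_card => x /H; lia.
case/exists_inP => v vS dv; have := vol_huge vS dv; have cB := card_out vS.
have /IH : #|S :\: cnbr S v| < m by lia.
nia.
Qed.

Lemma n_shift : n = n - 15 + 15.
Proof. by lia. Qed.

(** A neighbour of [b] in [B] either lies outside N_S[w], where [tfree_nbr] limits the number, or is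
    in N_B(w) and differs from [b]. If [b] has degree at most 3 in [S], one neighbour is [w],
    outside [B]. *)
Lemma nbr_inner S B w b : B \subset S -> w \in S :\: B -> b \in B ->
  e w b -> n - 4 <= #|nbr S w| ->
  #|nbr B b| <= 2 \/ #|nbr S w| + #|nbr B b| < n - 2 + #|nbr B w|.
Proof.
move=> sBS wSB bB ewb dw; have bS := subsetP sBS _ bB.
have wS : w \in S by move: wSB; rewrite inE => /andP[].
have bN : b \in nbr S w by rewrite in_nbr bS ewb.
have [low|] := tfree_nbr wS bN dw.
  left; have lt : #|nbr B b| < #|nbr S b|.
    rewrite (nbrID _ sBS) -addn1 leq_add2l card_gt0; apply/set0Pn; exists w.
    by rewrite in_nbr wSB e_sym.
  lia.
move=> H; right.
have : nbr B b \subset nbr (S :\: cnbr S w) b :|: nbr B w :\ b.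
  apply/subsetP => y; rewrite !inE => /andP[yB eby].
  have yb : y != b by apply: contraTneq eby => ->; rewrite e_irr.
  have yw : y != w by apply: contraTneq yB => ->; move: wSB; rewrite inE => /andP[].
  by rewrite yB (subsetP sBS _ yB) eby yb (negPf yw) /= !andbT; case: (e w y).
move/subset_leq_card/leq_trans/(_ (leq_card_setU _ _)).
have : b \in nbr B w by rewrite in_nbr bB.
by rewrite (cardsD1 b (nbr B w)) => ->; lia.
Qed.

(* The second alternative, needed only for j = 6, is the bound
   (11n - 47)/2 on the deficiency that the exceptional graph attains up to parity. *)
Definition bound j (S : {set V}) :=
  vol S S + j * (n - 2) <= (n - 2) * #|S| + 30 \/
  j = 6 /\ 2 * vol S S + 11 * n <= 2 * (n - 2) * #|S| + 47.

(** A clique on n - 1 - j vertices has deficiency j(n - 1 - j) = j(n - 2) - j(j - 1). The constant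
    30 of [bound] is j(j - 1) at j = 6. *)
Lemma bound_small j S : j <= 6 -> #|S| + j = n - 1 -> bound j S.
Proof.
move=> j6 cS; left; have := vol_clique S.
have -> : #|S| = n - 1 - j by lia.
do 7?[case: j j6 cS => [|j] //= j6 cS]; nia.
Qed.

(** Each vertex contributes at least 2 to the deficiency, which suffices once |S| is at least 3(n -
    1) - 6 or j is at most 4. *)
Lemma bound_maxdeg k j S : j <= 6 -> #|S| + j = k.+2 * (n - 1) ->
  (forall x, x \in S -> #|nbr S x| <= n - 4) ->
  0 < k \/ j <= 4 -> bound j S.
Proof.
move=> j6 cS dS kj; left; have : vol S S <= (n - 4) * #|S| := leq_sum_card dS.
have : 2 * #|S| + 30 >= j * (n - 2).
  by case: kj => [k0|j4]; [have : 3 * (n - 1) <= k.+2 * (n - 1)|]; nia.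
nia.
Qed.

(** * The case of maximum degree n - 4 *)

Section MaxDegree.

Variables (S : {set V}) (v : V).
Hypotheses (dv : #|nbr S v| = n - 4) (vS : v \in S).
Hypothesis (dS : forall x, x \in S -> #|nbr S x| <= n - 4).

Let A := cnbr S v.
Let B := S :\: A.
Let H := [set u in A | #|nbr S u| == n - 4].

Let cA : #|A| = n - 3.
Proof. by rewrite card_cnbr dv; lia. Qed.

Let cB : #|B| + (n - 3) = #|S|.
Proof. by rewrite -(card_out vS) dv -/B; lia. Qed.

Let sAS : A \subset S := cnbr_sub vS.

Let out_le2 w : w \in A -> #|nbr B w| <= 2.
Proof.
rewrite in_setU1 => /orP[/eqP->|wN]; first by rewrite nbr_out_self.
exact: full_out_le2.
Qed.

(* Since d(w) = n - 4, b has at most three neighbours in B, so B is far from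
   complete. *)
Lemma bound_full_edge w b j : 5 <= j <= 6 -> #|S| + j = 2 * (n - 1) ->
  w \in A -> b \in B -> e w b -> #|nbr S w| = n - 4 -> bound j S.
Proof.
move=> j56 cS wA bB ewb dw; left.
have wS := subsetP sAS _ wA.
have db : #|nbr B b| <= 3.
  have wSB : w \in S :\: B by rewrite !in_setD wA wS.
  have := @nbr_inner S B _ _ (subsetDl _ _) wSB bB ewb; rewrite dw => /(_ (leqnn _)).
  have := out_le2 wA; lia.
have h w' : w' \in nbr S v -> #|nbr S w'| + #|nbr B w'| <= n - 2.
  move=> w'N; have w'A : w' \in A by rewrite inE w'N orbT.
  by have := out_le2 w'A; have := dS (subsetP sAS _ w'A); lia.
have := vol_remove_cnbr vS h; rewrite -/A -/B dv (vol_remove1 bB).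
have := vol_clique (B :\ b).
have : #|B :\ b| = n - j by have := cardsD1 b B; rewrite bB; lia.
move=> -> /=.
have -> : #|S| = 2 * n - 2 - j by lia.
have [->|->] : j = 5 \/ j = 6 by lia.
all: nia.
Qed.

(** From here on, the situation left over by [bound_full_edge]. *)
Hypothesis (H_out : forall w b, w \in A -> b \in B -> e w b -> #|nbr S w| <= n - 5).

Let H_nbr u : u \in H -> nbr B u = set0.
Proof.
rewrite inE => /andP[uA /eqP du]; apply/eqP; rewrite -subset0.
apply/subsetP => b; rewrite in_nbr => /andP[bB eub].
by have := H_out uA bB eub; rewrite du; lia.
Qed.

Let sHA : H \subset A.
Proof. by apply/subsetP => u; rewrite inE => /andP[]. Qed.

Let dNH u : u \in A :\: H -> #|nbr S u| <= n - 5.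
Proof.
rewrite in_setD => /andP[uH uA]; move: uH; rewrite inE uA /= => du.
have := dS (subsetP sAS _ uA); lia.
Qed.

(** All n - 4 neighbours of [u] lie in [A], which has only n - 4 other vertices. *)
Let H_universal u a : u \in H -> a \in A -> a != u -> e u a.
Proof.
move=> uH aA au; have uA := subsetP sHA _ uH.
have sub : nbr A u \subset A :\ u.
  apply/subsetP => y; rewrite !inE => /andP[-> euy]; rewrite andbT.
  by apply: contraTneq euy => ->; rewrite e_irr.
have E : #|nbr A u| = #|A :\ u|.
  have := nbrID u sAS; rewrite -/B H_nbr // cards0 addn0 => <-.
  have := cardsD1 u A; rewrite uA cA => E'.
  by move: uH; rewrite inE => /andP[_ /eqP->]; lia.
have /(subset_cardP E)/(_ a) := sub.
by rewrite in_setD1 in_nbr aA au.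
Qed.

(* Every vertex of H is adjacent to a but not to b, and at most two neighbours
   of a lie outside N[b]. *)
Lemma full_out a b : a \in A -> b \in B -> e a b -> #|nbr S b| = n - 4 ->
  #|H| <= 2 /\ #|nbr S a| <= #|nbr A b| + 3.
Proof.
move=> aA bB eab db; have bS : b \in S by move: bB; rewrite inE => /andP[].
have aS := subsetP sAS _ aA.
have aN : a \in nbr S b by rewrite in_nbr aS e_sym.
have aH : a \notin H.
  by apply/negP => /H_nbr/setP/(_ b); rewrite in_nbr bB eab inE.
have bA : b \notin A by move: bB; rewrite inE => /andP[].
set C := S :\: cnbr S b.
have da2 : #|nbr C a| <= 2.
  exact: full_out_le2.
split.
  apply: leq_trans da2; apply/subset_leq_card/subsetP => u uH.
  have uA := subsetP sHA _ uH; have uS := subsetP sAS _ uA.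
  have ub : u != b by apply: contraNneq bA => <-.
  have nub : ~~ e b u.
    by rewrite e_sym; apply/negP => eub; have /setP/(_ b) := H_nbr uH;
       rewrite in_nbr bB eub inE.
  have au : a != u by apply: contraNneq aH => ->.
  by rewrite !inE (negPf ub) (negPf nub) uS /= e_sym (H_universal uH aA au).
rewrite (nbrID a (cnbr_sub bS)) -/C.
have : nbr (cnbr S b) a \subset nbr B a :|: nbr A b :\ a.
  apply/subsetP => y; rewrite in_nbr in_setU1 => /andP[/orP[/eqP->|yN] eay].
    by rewrite in_setU in_nbr bB eab.
  move: yN; rewrite in_nbr => /andP[yS eby].
  have ya : y != a by apply: contraTneq eay => ->; rewrite e_irr.
  rewrite in_setU in_setD1 !in_nbr eay eby ya !andbT in_setD yS.
  by case: (y \in A).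
move/subset_leq_card/leq_trans/(_ (leq_card_setU _ _)).
have := out_le2 aA; have := cardsD1 a (nbr A b).
by rewrite in_nbr aA e_sym eab; move: da2; clear; lia.
Qed.

Let B_nbr b : b \in B -> #|nbr S b| = n - 4 -> n - 3 <= #|B| + #|nbr A b|.
Proof.
move=> bB db; have := nbrID b sAS; rewrite -/B db.
have : nbr B b \subset B :\ b.
  apply/subsetP => y; rewrite !inE -/A => /andP[-> eby]; rewrite andbT.
  by apply: contraTneq eby => ->; rewrite e_irr.
by move/subset_leq_card; have := cardsD1 b B; rewrite bB; move: n_ge15; clear; lia.
Qed.

Let volAB : vol A B <= 2 * (#|A| - #|H|).
Proof.
rewrite (volDl _ sHA); have -> : vol H B = 0.
  by apply: big1 => u uH; rewrite H_nbr // cards0.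
have -> : #|A| - #|H| = #|A :\: H| by rewrite cardsD (setIidPr sHA).
by apply: leq_sum_card => u; rewrite inE => /andP[_ /out_le2].
Qed.

Let volAS : vol A S <= (n - 5) * #|A| + #|H|.
Proof.
rewrite (volDl _ sHA).
have h1 : vol H S <= (n - 4) * #|H|.
  by apply: leq_sum_card => u; rewrite inE => /andP[_ /eqP->].
have h2 : vol (A :\: H) S <= (n - 5) * #|A :\: H| by exact: leq_sum_card.
have := cardsID H A; rewrite (setIidPr sHA); nia.
Qed.

Let volS : vol S S = vol A S + vol B S.
Proof. by rewrite (volDl _ sAS). Qed.

Let volS' : vol S S = vol A S + vol A B + vol B B.
Proof. by rewrite (vol_remove sAS) big_split. Qed.

Let leHA : #|H| <= n - 3.
Proof. by rewrite -cA subset_leq_card. Qed.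

(** The estimate from [volS] increases with |H|, the one from [volS'] decreases. For j = 5 the first
    suffices, as |H| <= n - 3. For j = 6 their sum is free of |H| and is exactly the second
    alternative of [bound]. *)
Lemma bound_full_none j : 5 <= j <= 6 -> #|S| + j = 2 * (n - 1) ->
  (forall b, b \in B -> #|nbr S b| <= n - 5) -> bound j S.
Proof.
move=> j56 cS dB; have h1 : vol B S <= (n - 5) * #|B| := leq_sum_card dB.
have h2 := vol_clique B.
have cB' : #|B| = n + 1 - j by lia.
have [jE|jE] : j = 5 \/ j = 6 by lia.
  left; move: volAS volAB volS volS' leHA h1 h2.
  rewrite cA cB' (_ : #|S| = 2 * n - 2 - j); last by lia.
  by rewrite jE n_shift; move: (n - 15) => m; rewrite !shift_sub; lia.
right; split => //; move: volAS volAB volS volS' leHA h1 h2.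
  rewrite cA cB' (_ : #|S| = 2 * n - 2 - j); last by lia.
by rewrite jE n_shift; move: (n - 15) => m; rewrite !shift_sub; lia.
Qed.

(** By [full_out], |H| <= 2, so almost all degrees in [A] are at most n - 5. This settles j = 5; for
    j = 6 up to n - 21 must still be saved. *)
Lemma bound_full_some j b : 5 <= j <= 6 -> #|S| + j = 2 * (n - 1) ->
  b \in B -> #|nbr S b| = n - 4 -> bound j S.
Proof.
move=> j56 cS bB db; left.
have cB' : #|B| = n + 1 - j by lia.
(* [B] has at most n - 4 vertices, too few to hold all n - 4 neighbours of one of its own
   vertices. *)
have hh x : x \in B -> #|nbr S x| = n - 4 -> exists2 a, a \in A & e a x.
  move=> xB dx; have := B_nbr xB dx; rewrite cB' => h.
  have : 0 < #|nbr A x| by lia.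
  by rewrite card_gt0 => /set0Pn[a]; rewrite in_nbr => /andP[aA exa];
     exists a; rewrite // e_sym.
have h2 : #|H| <= 2.
  by have [a aA eab] := hh _ bB db; case: (full_out aA bB eab db).
have hB : vol B S <= (n - 4) * #|B|.
  by apply: leq_sum_card => x; rewrite inE => /andP[_ /dS].
have [j5|j6] : j = 5 \/ j = 6 by lia.
  move: volAS volS hB h2; rewrite cA cB' (_ : #|S| = 2 * n - 2 - j); last by lia.
  by rewrite j5 n_shift; move: (n - 15) => m; rewrite !shift_sub; clear; lia.
set Q := [set x in B | #|nbr S x| == n - 4].
case: (boolP [exists x in Q, #|nbr A x| <= n - 10]).
  case/exists_inP => x; rewrite inE => /andP[xB /eqP dx] tx.
  have := B_nbr xB dx; rewrite cB' => t2.
  set t := #|nbr A x| in tx t2.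
  have sNA := nbr_sub A x.
  have e1 := volDl S sNA.
  have v1 : vol (nbr A x) S <= (t + 3) * t.
    apply: leq_sum_card => a; rewrite in_nbr => /andP[aA exa].
    by rewrite e_sym in exa; case: (full_out aA xB exa dx).
  have v2 : vol (A :\: nbr A x) S <= (n - 5) * (#|A| - t) + #|H|.
    rewrite (_ : #|A| - t = #|A :\: nbr A x|); last first.
      by rewrite cardsD (setIidPr sNA).
    rewrite -[#|_ :\: nbr A x|]sum1_card big_distrr /= -[X in _ + X]sum1_card.
    rewrite [X in _ + X](big_setID (A :\: nbr A x)) /= addnA.
    apply: leq_trans (leq_addr _ _).
    rewrite [\sum_(i in H :&: _) _](_ : _ = \sum_(i in A :\: nbr A x) (i \in H)).
      rewrite -big_split /=; apply: leq_sum => a aA.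
      have aA' : a \in A by move: aA; rewrite inE => /andP[].
      have := dS (subsetP sAS _ aA'); case: (boolP (a \in H)) => aH.
        by move: n_ge15; clear; lia.
      by move=> _; rewrite muln1 addn0; apply: dNH; rewrite in_setD aH aA'.
    rewrite big_mkcond [RHS]big_mkcond; apply: eq_bigr => a _.
    by rewrite [a \in _ :&: _]inE; case: (a \in H); case: (a \in _ :\: _).
  (* The saving over (n - 5)(n - 3) is t(n - 8 - t). It is concave in t, hence at least 2(n - 10),
     its value at both ends t = 2 and t = n - 10. *)
  have v3 : (t + 3) * t + (n - 5) * (n - 3 - t) <= (n - 5) * (n - 5) + 10.
    move: t2 tx n_ge15 j6; clear; move: t => t t2 tx n15 j6.
    have [s tE] : exists s, t = s + 2 by exists (t - 2); lia.
    have [u nE] : exists u, n = s + u + 12 by exists (n - 10 - t); lia.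
    have -> : n - 5 = s + u + 7 by lia.
    have -> : n - 3 - t = u + 7 by lia.
    by rewrite tE; clear; nia.
  move: volS hB h2 e1 v1 v2 v3; rewrite cA cB' j6 (_ : #|S| = 2 * n - 8).
    by rewrite n_shift; move: (n - 15) => m; rewrite !shift_sub; clear; lia.
  by lia.
move=> /exists_inPn hQ.
(* Each vertex of [Q] has at least n - 9 neighbours in [A], while [volAB] allows at most 2(n - 4)
   edges between [A] and [B], as [v] is in [H]. For n >= 15, 4(n - 9) exceeds this. *)
have q3 : #|Q| <= 3.
  have : vol Q A >= (n - 9) * #|Q|.
    rewrite mulnC -sum_nat_const; apply: leq_sum => x /hQ; lia.
  have : vol Q A <= vol B A.
    have sQB : Q \subset B by apply/subsetP => x; rewrite inE => /andP[].
    by rewrite (volDl A sQB) leq_addr.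
  rewrite [vol B A]volC; move: volAB; rewrite cA.
  have : v \in H by rewrite !inE eqxx dv eqxx.
  move=> vH; have : 0 < #|H| by rewrite card_gt0; apply/set0Pn; exists v.
  have [//|q4] := leqP #|Q| 3; have := leq_mul (leqnn (n - 9)) q4.
  move: n_ge15; clear; lia.
have hB' : vol B S <= (n - 5) * #|B| + #|Q|.
  have sQB : Q \subset B by apply/subsetP => x; rewrite inE => /andP[].
  rewrite (volDl S sQB).
  have h3 : vol Q S <= (n - 4) * #|Q|.
    by apply: leq_sum_card => u; rewrite inE => /andP[_ /eqP->].
  have h4 : vol (B :\: Q) S <= (n - 5) * #|B :\: Q|.
    apply: leq_sum_card => u; rewrite in_setD => /andP[uQ uB]; move: uQ.
    rewrite inE uB /= => du.
    have /dS : u \in S by move: uB; rewrite inE => /andP[].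
    lia.
  have := cardsID Q B; rewrite (setIidPr sQB) => <-.
  rewrite mulnDr; move: h3; rewrite (_ : n - 4 = (n - 5).+1) ?mulSn; last by lia.
  by move: h4; clear; lia.
move: volS volAS hB' h2 q3; rewrite cA cB' j6 (_ : #|S| = 2 * n - 8).
  by rewrite n_shift; move: (n - 15) => m; rewrite !shift_sub; clear; lia.
by lia.
Qed.

End MaxDegree.

Lemma bound_full j S : 5 <= j <= 6 -> #|S| + j = 2 * (n - 1) ->
  (forall x, x \in S -> #|nbr S x| <= n - 4) -> bound j S.
Proof.
move=> j56 cS dS.
case: (boolP [exists v in S, #|nbr S v| == n - 4]); last first.
  move=> /exists_inPn d5; left.
  have : vol S S <= (n - 5) * #|S|.
    by apply: leq_sum_card => x xS; have := dS x xS; have := d5 x xS; lia.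
  have -> : #|S| = 2 * n - 2 - j by lia.
  have [->|->] : j = 5 \/ j = 6 by lia.
    by rewrite n_shift; move: (n - 15) => m; rewrite !shift_sub; clear; lia.
  by rewrite n_shift; move: (n - 15) => m; rewrite !shift_sub; clear; lia.
case/exists_inP => v vS /eqP dv; set A := cnbr S v; set B := S :\: A.
case: (boolP [exists w in A, exists b in B, e w b && (#|nbr S w| == n - 4)]).
  case/exists_inP => w wA /exists_inP[b bB /andP[ewb /eqP dw]].
  exact: (bound_full_edge dv vS dS j56 cS wA bB ewb dw).
move=> /exists_inPn noedge.
have H_out w b : w \in A -> b \in B -> e w b -> #|nbr S w| <= n - 5.
  move=> wA bB ewb; have /exists_inPn/(_ b bB) := noedge w wA.
  have /dS : w \in S := subsetP (cnbr_sub vS) _ wA.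
  by rewrite ewb /=; clear; lia.
case: (boolP [exists b in B, #|nbr S b| == n - 4]).
  case/exists_inP => b bB /eqP db.
  exact: (bound_full_some dv vS dS H_out j56 cS bB db).
move=> /exists_inPn d5; apply: (bound_full_none dv vS dS H_out j56 cS) => b bB.
have /dS : b \in S by move: bB; rewrite in_setD => /andP[].
by have := d5 b bB; clear; lia.
Qed.

Lemma bound_remove j S S' :
  #|S| = #|S'| + (n - 1) -> vol S S <= (n - 2) * (n - 1) + vol S' S' ->
  bound j S' -> bound j S.
Proof.
by rewrite /bound => -> le [|[j6]] h; [left|right; split => //];
   move: le h; rewrite mulnDr; clear; lia.
Qed.

(** The maximum degree decides. At n - 2, N[v] has n - 1 vertices and is removed with j unchanged.
    At n - 3, N[v] is one vertex short: either a vertex of small degree is removed with it, or j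
    drops by one. *)
Lemma bound_all k j S : j <= 6 -> #|S| + j = k.+1 * (n - 1) -> bound j S.
Proof.
elim: k j S => [|k IH] j S j6 cS.
  by apply: bound_small => //; rewrite cS mul1n.
case: (boolP [exists v in S, n - 1 <= #|nbr S v|]).
  (* [vol_le] suffices for the rest, since deleting N[v] alone accounts for a deficiency of at least
     6(n - 2). *)
  case/exists_inP => v vS dv; left.
  have h1 := vol_huge vS dv; have h2 := vol_le (S :\: cnbr S v).
  have h3 := card_out vS.
  have : j * (n - 2) <= 6 * (n - 2) by rewrite leq_mul2r j6 orbT.
  move: h1 h2 h3 dv n_ge15; clear.
  set d := #|nbr S v|; set s' := #|S :\: _| => h1 h2 <- dv n15 hj.
  have : (n - 2) * (s' + d.+1) = (n - 2) * s' + (n - 2) * d + (n - 2).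
    by clear; lia.
  have : 13 * d <= (n - 2) * d by rewrite leq_mul2r; move: n15; clear; lia.
  lia.
move=> /exists_inPn d1.
case: (boolP [exists v in S, #|nbr S v| == n - 2]).
  case/exists_inP => v vS /eqP dv; set B := S :\: cnbr S v.
  have cB : #|S| = #|B| + (n - 1) by have := card_out vS; rewrite -/B dv; lia.
  apply: (@bound_remove _ _ B) => //; last by apply: IH => //; rewrite mulSn in cS; lia.
  have h w : w \in nbr S v -> #|nbr S w| + #|nbr B w| <= n - 2.
    move=> wN; have wS := subsetP (nbr_sub S v) _ wN.
    have := nbr_out_lt wN vS; have := d1 w wS.
    by case: (tfree_nbr vS wN); rewrite ?dv -/B; move: n_ge15; clear; lia.
  have := vol_remove_cnbr vS h; rewrite -/B dv.
  have -> : n - 1 = (n - 2).+1 by move: n_ge15; clear; lia.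
  by rewrite mulnS; clear; lia.
move=> /exists_inPn d2.
case: (boolP [exists v in S, #|nbr S v| == n - 3]); last first.
  move=> /exists_inPn d3.
  have dS x : x \in S -> #|nbr S x| <= n - 4.
    by move=> xS; have := d1 x xS; have := d2 x xS; have := d3 x xS; clear; lia.
  case: (posnP k) => [k0|k0]; last by apply: bound_maxdeg cS dS _ => //; left.
  case: (leqP j 4) => [j4|j5]; first by apply: bound_maxdeg cS dS _ => //; right.
  by apply: bound_full => //; rewrite ?j5 // cS k0.
case/exists_inP => v vS /eqP dv; set A := cnbr S v; set B := S :\: A.
have sAS : A \subset S := cnbr_sub vS.
have cB : #|S| = #|B| + (n - 2) by have := card_out vS; rewrite -/B dv; lia.
have dS x : x \in S -> #|nbr S x| <= n - 3.
  by move=> xS; have := d1 x xS; have := d2 x xS; clear; lia.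
have out w : w \in A -> #|nbr B w| <= 1 \/ #|nbr S w| <= 3 /\ #|nbr B w| <= 2.
  rewrite in_setU1 => /orP[/eqP->|wN]; first by left; rewrite nbr_out_self.
  have := nbr_out_lt wN vS; have := tfree_nbr vS wN; rewrite dv -/A -/B.
  by move: n_ge15; clear; lia.
case: (boolP [exists w in A, exists b in B, e w b && (n - 4 <= #|nbr S w|)]).
  case/exists_inP => w wA /exists_inP[b bB /andP[ewb dw]].
  have wSB : w \in S :\: B by rewrite !in_setD wA (subsetP sAS _ wA).
  have db : #|nbr B b| <= 2.
    have := @nbr_inner S B _ _ (subsetDl _ _) wSB bB ewb dw.
    by have := out w wA; move: n_ge15 dw; clear; lia.
  have h w' : w' \in nbr S v -> #|nbr S w'| + #|nbr B w'| <= n - 2.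
    move=> w'N; have w'A : w' \in A by rewrite in_setU1 w'N orbT.
    have := dS _ (subsetP sAS _ w'A).
    by have := out _ w'A; move: n_ge15; clear; lia.
  have := vol_remove_cnbr vS h; rewrite -/A -/B dv (vol_remove1 bB) => hv.
  have cB' : #|S| = #|B :\ b| + (n - 1).
    by rewrite cB (cardsD1 b B) bB; move: n_ge15; clear; lia.
  apply: (@bound_remove _ _ (B :\ b)) => //.
    move: hv db; rewrite (_ : n - 1 = (n - 2).+1); last first.
      by move: n_ge15; clear; lia.
    rewrite n_shift; move: (n - 15) => m; rewrite !shift_sub; clear; lia.
  by apply: IH => //; move: cS; rewrite mulSn cB'; clear; lia.
move=> /exists_inPn noedge.
have h w : w \in nbr S v -> #|nbr S w| + #|nbr B w| <= n - 3.
  move=> wN; have wA : w \in A by rewrite in_setU1 wN orbT.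
  have dw := dS _ (subsetP sAS _ wA).
  have [->|[b]] := set_0Vmem (nbr B w); first by rewrite cards0 addn0.
  rewrite in_nbr => /andP[bB ewb].
  have /exists_inPn/(_ b bB) := noedge w wA; rewrite ewb /=.
  by have := out _ wA; move: n_ge15; clear; lia.
have hv := vol_remove_cnbr vS h; rewrite -/A -/B dv in hv.
case: j j6 cS => [|j] j6 cS; first by left; have := vol_le S; clear; lia.
(* The n - 2 removed vertices cost at most (n - 3)(n - 2), so they supply the n - 2 by which the
   deficiencies required for [j] and [j.+1] differ. *)
have : bound j B.
  by apply: IH; [lia|move: cS; rewrite mulSn cB; move: n_ge15; clear; lia].
case=> [hB|[jE _]]; last by move: j6; rewrite jE.
left; move: hv hB; rewrite cB n_shift; move: (n - 15) => m; rewrite !shift_sub.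
by clear; lia.
Qed.

End Degrees.

(** * Edge sets as adjacency relations *)

Lemma card_nbrT (V : finType) (e : rel V) x : #|nbr e setT x| = \sum_y e x y.
Proof.
rewrite -sum1_card big_mkcond /=; apply: eq_bigr => y _.
by rewrite in_nbr inE /=; case: (e x y).
Qed.

Lemma volT (V : finType) (e : rel V) :
  vol e setT setT = \sum_x \sum_y e x y.
Proof.
rewrite /vol; apply: eq_big => [x|x _]; first by rewrite inE.
exact: card_nbrT.
Qed.

Definition adj (V : finType) (G : {set {set V}}) : rel V :=
  fun x y => (x != y) && ([set x; y] \in G).

Lemma adj_sym (V : finType) (G : {set {set V}}) : symmetric (adj G).
Proof. by move=> x y; rewrite /adj eq_sym setUC. Qed.

Lemma adj_irr (V : finType) (G : {set {set V}}) : irreflexive (adj G).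
Proof. by move=> x; rewrite /adj eqxx. Qed.

Lemma handshake (V : finType) (G : {set {set V}}) :
  {in G, forall A : {set V}, #|A| = 2} -> vol (adj G) setT setT = 2 * #|G|.
Proof.
move=> G2.
have deg x : #|nbr (adj G) setT x| = \sum_(A in G) (x \in A).
  have inj : {in nbr (adj G) setT x &, injective (fun y => [set x; y])}.
    move=> y z; rewrite !in_nbr !inE => /= /andP[xy _] _ /setP/(_ y).
    by rewrite !inE eqxx orbT (eq_sym y x) (negPf xy) => /esym/eqP.
  rewrite -(card_in_imset inj) -sum1_card big_mkcond [RHS]big_mkcond /=.
  apply: eq_bigr => A _; rewrite (_ : (A \in _) = (A \in G) && (x \in A)).
    by case: (A \in G) => //=; case: (x \in A).
  apply/imsetP/andP => [[y]|[AG xA]].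
    by rewrite in_nbr inE /= => /andP[_ AG] ->; rewrite set21.
  have /cards2P[a [b [ab AE]]] : #|A| == 2 by rewrite (G2 _ AG).
  move: xA AG; rewrite AE !inE => /orP[]/eqP-> AG.
    by exists b; rewrite // in_nbr inE /adj ab AG.
  exists a; last by rewrite setUC.
  by rewrite in_nbr inE /adj eq_sym ab setUC AG.
rewrite /vol; under eq_bigr do rewrite deg.
rewrite exchange_big /= mulnC -sum_nat_const; apply: eq_bigr => A AG.
rewrite -(G2 _ AG) -sum1_card [RHS]big_mkcond [LHS]big_mkcond /=.
by apply: eq_bigr => x _; rewrite inE; case: (x \in A).
Qed.

(** * Embedding the double star *)

Section Embedding.

Variables (n p : nat) (G : {set {set 'I_p}}).
Hypothesis n_ge15 : 15 <= n.

Let e := adj G.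

Lemma T3_leaf0 (i j : 'I_n) : i = 0 :> nat -> 1 <= j <= n - 4 -> [set i; j] \in T3 n.
Proof.
move=> i0 jb; rewrite inE; apply/existsP; exists i; apply/existsP; exists j.
by rewrite eqxx /T3_adj /= i0 jb.
Qed.

Lemma T3_leaf1 (i j : 'I_n) : i = 1 :> nat -> n - 3 <= j <= n - 1 ->
  [set i; j] \in T3 n.
Proof.
move=> i0 jb; rewrite inE; apply/existsP; exists i; apply/existsP; exists j.
by rewrite eqxx /T3_adj /= i0 jb orbT.
Qed.

Lemma tfree_not_contains : tfree e n -> ~~ contains_sub (T3 n) G.
Proof.
move=> free; apply/negP => /existsP[f /andP[/injectiveP f_inj /forall_inP fG]].
have lt k : k < 15 -> k < n by lia.
pose i0 : 'I_n := Ordinal (lt 0 isT); pose i1 : 'I_n := Ordinal (lt 1 isT).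
have lt' k : 0 < k -> n - k < n by lia.
pose a1 : 'I_n := Ordinal (lt' 1 isT); pose a2 : 'I_n := Ordinal (lt' 2 isT).
pose a3 : 'I_n := Ordinal (lt' 3 isT).
have edge i j : i != j -> [set i; j] \in T3 n -> e (f i) (f j).
  by move=> ij /fG; rewrite imsetU1 imset_set1 /e /adj (inj_eq f_inj) ij.
have e0 (j : 'I_n) : 1 <= j <= n - 4 -> e (f i0) (f j).
  by move=> jb; apply: edge; [rewrite -val_eqE /i0 /=; lia|apply: T3_leaf0].
have e1 (j : 'I_n) : n - 3 <= j <= n - 1 -> e (f i1) (f j).
  by move=> jb; apply: edge; [rewrite -val_eqE /i1 /=; lia|apply: T3_leaf1].
have e01 : e (f i0) (f i1) by apply: e0; rewrite /i1 /=; lia.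
have e10 : e (f i1) (f i0) by rewrite /e adj_sym.
have cf : #|f @: setT| = n by rewrite card_imset // cardsT card_ord.
(* In the tree, vertex 0 is adjacent to all but itself and the three leaves n - 3, n - 2, n - 1. *)
have d0 : n - 4 <= #|nbr e setT (f i0)|.
  have : f @: setT \subset
      nbr e setT (f i0) :|: [set y in [:: f i0; f a1; f a2; f a3]].
    apply/subsetP => _ /imsetP[j _ ->]; rewrite !inE /=.
    have [jb|jb] := boolP (1 <= j <= n - 4); first by rewrite e0.
    have : [|| j == i0, j == a1, j == a2 | j == a3].
      by rewrite -!val_eqE /i0 /a1 /a2 /a3 /=; have := ltn_ord j; lia.
    by move/or4P => [] /eqP->; rewrite eqxx ?orbT.
  move/subset_leq_card/leq_trans/(_ (leq_card_setU _ _)); rewrite cf.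
  have : #|[set y in [:: f i0; f a1; f a2; f a3]]| <= 4.
    by rewrite cardsE; apply: card_size.
  by move=> h /leq_trans/(_ (leq_add (leqnn _) h)); rewrite leq_subLR addnC.
have d1 : 4 <= #|nbr e setT (f i1)|.
  have u : uniq [seq f j | j <- [:: i0; a1; a2; a3]].
    by rewrite (map_inj_uniq f_inj) /= !inE -!val_eqE /i0 /a1 /a2 /a3 /=; lia.
  rewrite cardE; apply: (uniq_leq_size u) => y; rewrite mem_enum in_nbr inE /=.
  rewrite !inE => /or4P[]/eqP->//; apply: e1; rewrite /a1 /a2 /a3 /=; lia.
suff : f @: setT \subset nbr e setT (f i0) :|: nbr e setT (f i1).
  move/subset_leq_card; rewrite cf => /leq_trans/(_ (free _ _ e01 d0 d1)).
  by move: n_ge15; clear; lia.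
apply/subsetP => _ /imsetP[j _ ->]; rewrite !inE /=.
have [->|jn0] := eqVneq j i0; first by rewrite e10 orbT.
have [jb|jb] := boolP (1 <= j <= n - 4); first by rewrite e0.
rewrite e1 ?orbT //; move: jn0; rewrite -val_eqE /i0 /=; have := ltn_ord j; lia.
Qed.

(** The three leaves at [w] are taken outside N[v] as far as possible. Common neighbours serve only
    if fewer than three such vertices exist, and then a union of size at least n still leaves n - 5
    leaves for [v]. *)
Lemma not_contains_tfree : ~~ contains_sub (T3 n) G -> tfree e n.
Proof.
move=> nc v w evw dv dw; rewrite leqNgt; apply: contra nc => big.
have evw' : e w v by rewrite /e adj_sym.
have vw : v != w by case/andP: evw.
set Nv := nbr e setT v in dv big *; set Nw := nbr e setT w in dw big *.
have vNw : v \in Nw by rewrite in_nbr inE.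
have wNv : w \in Nv by rewrite in_nbr inE.
have vNv : v \notin Nv by rewrite in_nbr /e adj_irr andbF.
have wNw : w \notin Nw by rewrite in_nbr /e adj_irr andbF.
pose C := Nw :\: (v |: Nv); pose M := (Nw :\ v) :&: Nv.
have cC : #|Nv :|: Nw| = #|Nv| + #|C| + 1.
  rewrite -(cardsID Nv) setUK (setDUl) setDv set0U -addnA; congr (_ + _).
  rewrite [in LHS](cardsD1 v) in_setD vNv vNw addnC; congr (_ + _).
  apply: eq_card => y; rewrite !in_setD !in_setU1 !in_set1.
  by rewrite negb_or -andbA.
have cM : #|Nw| = #|C| + #|M| + 1.
  have E : Nw :\ v :\: Nv = C.
    apply/setP => y; rewrite !in_setD in_setU1 in_set1 negb_or.
    by case: (y \in Nv); case: (y == v).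
  by rewrite (cardsD1 v Nw) vNw -(cardsID Nv (Nw :\ v)) E -/M; clear; lia.
pose s := enum C ++ enum M.
have s_uniq : uniq s.
  rewrite cat_uniq !enum_uniq andbT /=; apply/hasPn => y; rewrite !mem_enum.
  by rewrite !inE => /andP[_ ->]; rewrite orbT.
have size_s : size s = #|C| + #|M| by rewrite size_cat -!cardE.
pose Y := take 3 s.
have size_Y : size Y = 3 by rewrite size_takel // size_s; move: dw; rewrite cM; clear; lia.
have Y_uniq : uniq Y := take_uniq 3 s_uniq.
have YNw y : y \in Y -> (y \in Nw) && (y != v).
  move/mem_take; rewrite mem_cat !mem_enum in_setD in_setI in_setD1 in_setU1.
  by rewrite negb_or; case/orP=> [/andP[/andP[-> _] ->]|/andP[/andP[-> ->]]].
pose X := enum ((Nv :\ w) :\: [set y in Y]).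
have size_X : n - 5 <= size X.
  rewrite -cardE cardsD; have := cardsD1 w Nv; rewrite wNv.
  suff /subset_leq_card : (Nv :\ w) :&: [set y in Y] \subset [set y in drop #|C| Y].
    have : #|[set y in drop #|C| Y]| <= 3 - #|C|.
      by rewrite cardsE -size_Y -size_drop; apply: card_size.
    by move: big dv; rewrite cC; move: n_ge15; clear; lia.
  apply/subsetP => y; rewrite in_setI in_setD1 => /andP[/andP[_ yNv]].
  rewrite !inE => yY.
  move: yY; rewrite -{1}(cat_take_drop #|C| Y) mem_cat => /orP[|//].
  rewrite /Y -take_min; case: (leqP 3 #|C|) => h.
    rewrite /s takel_cat; last by rewrite -cardE.
    by move/mem_take; rewrite mem_enum in_setD in_setU1 yNv orbT.
  rewrite /s take_size_cat -?cardE //.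
  by rewrite mem_enum in_setD in_setU1 yNv orbT.
pose X' := take (n - 5) X.
have size_X' : size X' = n - 5 by rewrite size_takel.
have X_mem y : y \in X' -> [/\ y \in Nv, y != w & y \notin Y].
  move/mem_take; rewrite mem_enum in_setD in_setD1 [y \in [set _ in Y]]inE.
  by case/and3P.
(* Entry i is the image of tree vertex i: the two centres, the n - 5 leaves at 0, the three leaves
   at 1. *)
pose l := v :: w :: X' ++ Y.
have size_l : size l = n by rewrite /= size_cat size_X' size_Y; move: n_ge15; clear; lia.
have l_uniq : uniq l.
  rewrite /= inE negb_or vw cat_uniq Y_uniq take_uniq ?enum_uniq // !mem_cat /=.
  rewrite !negb_or !andbT; apply/and3P; split.
  - apply/andP; split; first by apply: contra vNv => /X_mem[].
    by apply/negP => /YNw; rewrite eqxx andbF.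
  - apply/andP; split; first by apply/negP => /X_mem[_]; rewrite eqxx.
    by apply: contra wNw => /YNw/andP[].
  - by apply/hasPn => y; apply: contraTN => /X_mem[].
pose f : {ffun 'I_n -> 'I_p} := [ffun i : 'I_n => nth v l i].
have fE i : f i = nth v l i by rewrite ffunE.
have f_inj : injective f.
  move=> i j; rewrite !fE => /eqP; rewrite nth_uniq ?size_l // => /eqP.
  exact: val_inj.
apply/existsP; exists f; apply/andP; split; first exact/injectiveP.
apply/forall_inP => E; rewrite inE => /existsP[i /existsP[j /andP[/eqP->]]].
rewrite imsetU1 imset_set1; have inG x y : e x y -> [set x; y] \in G by case/andP.
move=> ij; apply: inG; move: ij.
rewrite /T3_adj !fE /= => /orP[] /andP[/eqP ->] {i}.
  case: (nat_of_ord j) => [//|[|k]] /andP[_ kb] //=.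
  rewrite nth_cat size_X' (_ : k < n - 5); last by move: kb; clear; lia.
  have /X_mem[] : nth v X' k \in X'.
    by rewrite mem_nth // size_X'; move: kb; clear; lia.
  by rewrite in_nbr => /andP[].
case: (nat_of_ord j) => [|[|k]] /= kb; [move: kb n_ge15; clear; lia..|].
rewrite nth_cat size_X' (_ : k < n - 5 = false); last by move: kb; clear; lia.
have /YNw/andP[] : nth v Y (k - (n - 5)) \in Y.
  by rewrite mem_nth // size_Y; move: kb n_ge15; clear; lia.
by rewrite in_nbr => /andP[].
Qed.

End Embedding.

(** * Extremal graphs *)

(** Any finite vertex type is allowed, so that graphs can be assembled from sums and products; [m]
    is twice the number of edges. *)
Definition dense n p m := exists (V : finType) (e : rel V),
  [/\ #|V| = p, symmetric e, irreflexive e, tfree e n & vol e setT setT = m].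

Lemma dense_ex n p m : 15 <= n -> dense n p m -> m <= 2 * ex p (T3 n).
Proof.
move=> n15 [V [e [cV e_sym e_irr free <-]]].
pose g (i : 'I_p) : V := enum_val (cast_ord (esym cV) i).
pose h (x : V) : 'I_p := cast_ord cV (enum_rank x).
have hK : cancel h g by move=> x; rewrite /g /h cast_ordK enum_rankK.
have gK : cancel g h by move=> i; rewrite /g /h enum_valK cast_ordKV.
pose G : {set {set 'I_p}} :=
  [set A | [exists i, exists j, e (g i) (g j) && (A == [set i; j])]].
have adjE i j : adj G i j = e (g i) (g j).
  rewrite /adj inE; apply/andP/idP => [[ij /existsP[a /existsP[b /andP[eab]]]]|eij].
    move=> /eqP E; have /set2P[ia|ib] : i \in [set a; b] by rewrite -E set21.
      have /set2P[ja|->] : j \in [set a; b] by rewrite -E set22.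
        by rewrite ia ja eqxx in ij.
      by rewrite ia.
    have /set2P[->|jb] : j \in [set a; b] by rewrite -E set22.
      by rewrite ib e_sym.
    by rewrite ib jb eqxx in ij.
  split; first by apply: contraTneq eij => ->; rewrite e_irr.
  by apply/existsP; exists i; apply/existsP; exists j; rewrite eij eqxx.
have G2 : {in G, forall A : {set 'I_p}, #|A| = 2}.
  move=> A; rewrite inE => /existsP[i /existsP[j /andP[eij /eqP->]]].
  by rewrite cards2 (_ : i != j) //; apply: contraTneq eij => ->; rewrite e_irr.
have nbrE i : nbr e setT (g i) = g @: nbr (adj G) setT i.
  apply/setP => y; rewrite in_nbr inE; apply/idP/imsetP => [eiy|[j]].
    by exists (h y); rewrite ?hK // in_nbr inE adjE hK.
  by rewrite in_nbr inE adjE => eij ->.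
have freeG : tfree (adj G) n.
  move=> i j; rewrite adjE => /free; rewrite !nbrE -imsetU.
  by rewrite !card_imset //; apply: can_inj gK.
have -> : vol e setT setT = 2 * #|G|.
  rewrite -handshake // !volT (reindex g); last by exists h => x _.
  apply: eq_bigr => i _; rewrite (reindex g); last by exists h => x _.
  by apply: eq_bigr => j _; rewrite adjE.
rewrite leq_mul2l /=.
apply: (@leq_bigmax_cond _ _ (fun G : {set {set 'I_p}} => #|G|)).
rewrite tfree_not_contains // andbT.
by apply/forall_inP => A /G2 ->.
Qed.

Lemma vol_neq (T : finType) (x : T) : \sum_y (x != y) = #|T|.-1.
Proof.
rewrite -(cardC1 x) -sum1_card [RHS]big_mkcond; apply: eq_bigr => y _.
by rewrite !inE eq_sym; case: (_ == _).
Qed.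

Lemma sum_neq_inj (T : finType) (U : eqType) (f : T -> U) (x : T) :
  injective f -> \sum_y (f x != f y) = #|T|.-1.
Proof.
by move=> f_inj; rewrite -(vol_neq x); apply: eq_bigr => y _; rewrite inj_eq.
Qed.

Lemma dense_clique n m : m <= n - 1 -> dense n m (m * m.-1).
Proof.
move=> mn; exists 'I_m, (fun x y => x != y); split.
- exact: card_ord.
- by move=> x y; rewrite eq_sym.
- by move=> x; rewrite eqxx.
- by move=> v w _ _ _; apply: leq_trans mn; rewrite -[leqRHS]card_ord max_card.
- rewrite volT; under eq_bigr do rewrite vol_neq.
  by rewrite sum_nat_const card_ord.
Qed.

Definition sum_rel (V W : finType) (e : rel V) (f : rel W) : rel (V + W) :=
  fun x y => match x, y with
    | inl x, inl y => e x y
    | inr x, inr y => f x y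
    | _, _ => false
  end.

Lemma dense_union n p q a b : dense n p a -> dense n q b -> dense n (p + q) (a + b).
Proof.
move=> [V [e [cV e_sym e_irr e_free <-]]] [W [f [cW f_sym f_irr f_free <-]]].
have nl x : nbr (sum_rel e f) setT (inl x) = inl @: nbr e setT x.
  apply/setP => y; rewrite in_nbr inE; apply/idP/imsetP => [|[z]].
    by case: y => //= y exy; exists y; rewrite // in_nbr inE.
  by rewrite in_nbr inE => exz ->.
have nr x : nbr (sum_rel e f) setT (inr x) = inr @: nbr f setT x.
  apply/setP => y; rewrite in_nbr inE; apply/idP/imsetP => [|[z]].
    by case: y => //= y exy; exists y; rewrite // in_nbr inE.
  by rewrite in_nbr inE => exz ->.
have il : injective (@inl V W) by move=> ? ? [].
have ir : injective (@inr V W) by move=> ? ? [].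
exists (V + W)%type, (sum_rel e f); split.
- by rewrite card_sum cV cW.
- by move=> [x|x] [y|y] /=; rewrite 1?e_sym 1?f_sym.
- by move=> [x|x] /=; rewrite ?e_irr ?f_irr.
- move=> [v|v] [w|w] //= evw; rewrite ?nl ?nr -imsetU !card_imset //.
    exact: e_free.
  exact: f_free.
- rewrite !volT big_sumType /=; congr (_ + _); apply: eq_bigr => x _;
    rewrite big_sumType /=; [rewrite [X in _ + X]big1 // | rewrite [X in X + _]big1 //].
  by rewrite addn0.
Qed.

Lemma dense_cliques n p m k : dense n p m ->
  dense n (k * (n - 1) + p) (k * ((n - 1) * (n - 2)) + m).
Proof.
move=> d; elim: k => [//|k IH]; rewrite !mulSn -!addnA.
apply: dense_union IH; rewrite (_ : n - 2 = (n - 1).-1); last by lia.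
exact: dense_clique.
Qed.

(** * The exceptional graph on 2n - 8 vertices *)

Section Exceptional.

Variables (T : finZmodType) (D : {set T}) (h s : nat).
Hypothesis cD : #|D| = 3.

Notation core := (bool * T)%type.
Notation near := (core + 'I_h)%type.
Notation far := (core * bool + 'I_s)%type.

(* In [core] the complement is a 3-regular bipartite circulant, so that each
   core vertex can be joined to two vertices of the clique [far] and still have
   degree n - 5.  The vertices of ['I_h] are joined to all of [near] and to
   nothing else, and have degree n - 4. *)
Definition core_rel : rel core := fun x y =>
  match x, y with
  | (false, i), (true, j) => (j - i)%R \notin D
  | (true, j), (false, i) => (j - i)%R \notin D
  | (_, i), (_, j) => i != j
  end.

Definition near_rel : rel near := fun x y =>
  match x, y with
  | inl x, inl y => core_rel x y
  | x, y => x != y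
  end.

Definition exc_rel : rel (near + far) := fun x y =>
  match x, y with
  | inl x, inl y => near_rel x y
  | inr x, inr y => x != y
  | inl (inl x), inr (inl y) | inr (inl y), inl (inl x) => x == y.1
  | _, _ => false
  end.

Lemma exc_sym : symmetric exc_rel.
Proof. by move=> [[[[] i]|x]|[x|x]] [[[[] j]|y]|[y|y]] //=; rewrite eq_sym. Qed.

Lemma exc_irr : irreflexive exc_rel.
Proof.
by move=> [[[[] i]|x]|[x|x]]; rewrite /exc_rel /near_rel /core_rel ?eqxx.
Qed.

Lemma sum_notin (B : {set T}) : \sum_y (y \notin B : nat) = #|T| - #|B|.
Proof.
rewrite -(cardsC B) addKn -sum1_card [RHS]big_mkcond; apply: eq_bigr => y _.
by rewrite inE; case: (y \in B).
Qed.

Lemma core_deg x : \sum_y (core_rel x y : nat) = #|T|.-1 + (#|T| - 3).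
Proof.
have E (F : core -> nat) : \sum_y F y = \sum_j F (true, j) + \sum_j F (false, j).
  rewrite -(big_bool _ (fun b => \sum_j F (b, j))) pair_bigA /=.
  by apply: eq_bigr => -[].
case: x => -[] i; rewrite E /= vol_neq.
  congr (_ + _); rewrite -cD -sum_notin.
  rewrite (reindex_inj (h := fun j => i - j)%R) /=.
    by apply: eq_bigr => j _; rewrite GRing.subKr.
  by move=> a b /(GRing.addrI i)/(@GRing.oppr_inj T).
rewrite addnC; congr (_ + _); rewrite -cD -sum_notin.
rewrite (reindex_inj (h := fun j => j + i)%R) /=.
  by apply: eq_bigr => j _; rewrite GRing.addrK.
exact: GRing.addIr.
Qed.

Lemma sum_const1 (I : finType) : \sum_(i : I) (true : nat) = #|I|.
Proof. by rewrite sum1_card. Qed.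

Lemma sum_match (I : finType) (x : I) : \sum_(y : I * bool) (x == y.1 : nat) = 2.
Proof.
rewrite -(pair_bigA _ (fun (a : I) (b : bool) => (x == a : nat))) /=.
rewrite (bigD1 x) //= eqxx big_bool big1 // => y yx.
by rewrite big_bool eq_sym (negPf yx).
Qed.

Lemma sum_match1 (I : finType) (x : I) : \sum_y (y == x : nat) = 1.
Proof. by rewrite (bigD1 x) //= eqxx big1 // => y /negPf->. Qed.

Lemma exc_deg c x : #|T| = c -> 3 <= c -> #|nbr exc_rel setT x| =
  match x with
  | inl (inl _) => 2 * c + h - 2
  | inl (inr _) => 2 * c + h - 1
  | inr (inl _) => 4 * c + s
  | inr (inr _) => 4 * c + s - 1
  end.
Proof.
move=> cT c3; rewrite card_nbrT.
case: x => [[x|x]|[x|x]]; rewrite !big_sumType /=.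
- rewrite core_deg sum_match sum_const1 card_ord big1 //.
  by rewrite ?cT; move: c3; clear; lia.
- rewrite (@sum_neq_inj _ _ (@inr core 'I_h)); last by move=> ? ? [].
  rewrite sum_const1 !big1 // card_prod card_bool card_ord cT.
  by have := ltn_ord x; clear; lia.
- rewrite (@sum_neq_inj _ _ (@inl (core * bool) 'I_s)); last by move=> ? ? [].
  rewrite sum_match1 sum_const1 big1 // !card_prod card_bool card_ord cT.
  by move: c3; clear; lia.
- rewrite (@sum_neq_inj _ _ (@inr (core * bool) 'I_s)); last by move=> ? ? [].
  rewrite sum_const1 !big1 // !card_prod card_bool card_ord cT.
  by have := ltn_ord x; clear; lia.
Qed.

End Exceptional.

(** Only the vertices of ['I_h] have degree n - 4. Their neighbours lie among the n - 3 near
    vertices and have at most two neighbours elsewhere, so the union has at most n - 1 vertices. *)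
Lemma dense_exc n : 37 <= n ->
  dense n (2 * n - 8) (2 * (n * n) + 42 + 2 * ((n - 5) %/ 4) - 18 * n).
Proof.
move=> n37; set t := (n - 5) %/ 4; set s := (n - 5) %% 4.
have nE : n = 4 * t + s + 5 by rewrite /t /s; lia.
have s4 : s < 4 by rewrite ltn_mod.
have t8 : 8 <= t by lia.
have tE : t.-1.+1 = t by rewrite prednK //; lia.
(* The successor form gives the cyclic group of order t; any three of its elements serve as [D]. *)
pose T : finZmodType := 'I_t.-1.+1.
have cT : #|T| = t by rewrite card_ord tE.
pose D : {set T} := [set x in take 3 (enum T)].
have cD : #|D| = 3.
  rewrite cardsE (card_uniqP _) ?take_uniq ?enum_uniq // size_takel //.
  by rewrite -cardE cT; lia.
(* Chosen so that the near side has 2t + h = n - 3 vertices; the far side has 4t + s = n - 5. *)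
pose h := 2 * t + s + 2.
pose e := @exc_rel T D h s.
have t3 : 3 <= t by lia.
have deg x := @exc_deg T D h s cD t x cT t3; rewrite -/e in deg.
exists ((bool * T + 'I_h) + (bool * T * bool + 'I_s))%type, e; split.
- by rewrite !card_sum !card_prod !card_bool !card_ord tE; lia.
- exact: exc_sym.
- exact: exc_irr.
- move=> v w; rewrite (deg v).
  case: v => [[x|x]|[x|x]] + dv; [lia| |lia|lia].
  case: w => [w|w] // _ _.
  pose A : {set (bool * T + 'I_h) + (bool * T * bool + 'I_s)} := [set inl y | y : _].
  have cA : #|A| = n - 3.
    rewrite card_imset; last by move=> ? ? [].
    by rewrite !card_sum !card_prod !card_bool !card_ord tE nE /h; clear; lia.
  have inA y : inl y \in A by apply: imset_f.
  have [C cC sC] : exists2 C : {set _}, #|C| <= 2 & nbr e setT (inl w) \subset A :|: C.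
    case: w => w.
      exists [set inr (inl (w, false)); inr (inl (w, true))].
        by rewrite cards2; case: (_ != _).
      apply/subsetP => -[y|[[y b]|y]]; rewrite in_nbr inE //=.
        by rewrite in_setU inA.
      by move=> /eqP<-; case: b; rewrite !inE eqxx ?orbT.
    exists set0; first by rewrite cards0.
    apply/subsetP => -[y|[y|y]]; rewrite in_nbr inE //= => _.
    by rewrite in_setU inA.
  apply: (@leq_trans #|A :|: C|).
    apply/subset_leq_card; rewrite subUset sC andbT.
    apply/subsetP => -[y|[y|y]]; rewrite in_nbr inE //= => _.
    by rewrite in_setU inA.
  apply: leq_trans (leq_card_setU _ _) _; rewrite cA.
  by move: cC n37; clear; lia.
- rewrite /vol; under eq_bigr do rewrite deg.
  rewrite (eq_bigl xpredT); last by move=> x; rewrite inE.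
  rewrite !big_sumType /= !sum_nat_const !card_prod card_bool !card_ord tE.
  rewrite /h nE; move: t8; clear; move: s t => s t t8.
  rewrite (_ : 2 * t + (2 * t + s + 2) - 2 = 4 * t + s); last by lia.
  rewrite (_ : 2 * t + (2 * t + s + 2) - 1 = 4 * t + s + 1); last by lia.
  rewrite (_ : t = t - 8 + 8); last by lia.
  move: (t - 8) => {t8}t; case: s => [|s]; lia.
Qed.

(** * Lower and upper bounds for the extremal number *)

Lemma ex_lower p n k : 15 <= n -> 0 < k -> p = k * (n - 1) + n - 7 ->
  (n - 2) * p - 6 * (n - 7) + 2 * ((n - 37) %/ 4) <= 2 * ex p (T3 n).
Proof.
move=> n15; case: k => // k _ ->; have [n37|n37] := leqP 37 n.
  (* The exceptional graph replaces one K_(n-1) together with K_(n-7). *)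
  have := dense_ex n15 (dense_cliques k (dense_exc n37)).
  have -> : k * (n - 1) + (2 * n - 8) = k.+1 * (n - 1) + n - 7.
    by rewrite (mulSn k); move: (k * _) n15; clear; lia.
  apply: leq_trans.
  have -> : (n - 37) %/ 4 = (n - 5) %/ 4 - 8 by lia.
  have : 8 <= (n - 5) %/ 4 by lia.
  move: ((n - 5) %/ 4) => t t8.
  rewrite (n_shift n15); move: (n - 15) => m; rewrite !shift_sub (mulSn k).
  have -> : m + 14 + k * (m + 14) + (m + 15) - 7 = k * (m + 14) + (2 * m + 22).
    by move: (k * _); clear; lia.
  rewrite (_ : m + 15 - 7 = m + 8) ?mulnDr; last by lia.
  (* Keeps the truncated subtraction of 18n in [dense_exc] exact. *)
  have : 18 * m + 18 * 15 <= 2 * ((m + 15) * (m + 15)) + 42 by nia.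
  lia.
have c7 : n - 7 <= n - 1 by lia.
have := dense_ex n15 (dense_cliques k.+1 (dense_clique c7)).
rewrite -addnBA; last by lia.
apply: leq_trans; rewrite (_ : n - 37 = 0) ?div0n ?muln0 ?addn0; last by lia.
rewrite (_ : (n - 7).-1 = n - 8); last by lia.
rewrite (n_shift n15); move: (n - 15) => m; rewrite !shift_sub.
rewrite (_ : m + 15 - 7 = m + 8); last by lia.
rewrite (_ : m + 15 - 8 = m + 7); last by lia.
by clear; lia.
Qed.

(** Since p + 6 = (k + 1)(n - 1), [bound_all] applies with j = 6. Its second alternative gives |G|
    <= (n - 2)p/2 - (11n - 47)/4, where (11n - 47)/4 = 3(n - 7) - (n - 37)/4. *)
Lemma ex_upper p n k : 15 <= n -> 0 < k -> p = k * (n - 1) + n - 7 ->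
  2 * ex p (T3 n) <= (n - 2) * p - 6 * (n - 7) + 2 * ((n - 37) %/ 4).
Proof.
move=> n15 k0 pE; set X := (X in _ <= X).
suff : ex p (T3 n) <= X %/ 2 by lia.
apply/bigmax_leqP => G /andP[/forall_inP G2 nc].
have free := not_contains_tfree n15 nc.
have G2' : {in G, forall A : {set 'I_p}, #|A| = 2} by move=> A /G2/eqP.
have cS : #|[set: 'I_p]| + 6 = k.+1 * (n - 1) by rewrite cardsT card_ord pE (mulSn k); lia.
have := bound_all (@adj_sym _ G) (@adj_irr _ G) n15 free (leqnn 6) cS.
rewrite /bound handshake // cardsT card_ord.
(* As (n - 2)p/2 is an integer, rounding affects only (n - 37)/4. For odd n both k(n - 1) and n - 7
   are even. *)
have [E EE] : exists E, (n - 2) * p = 2 * E.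
  exists (((n - 2) * p) %/ 2); apply/esym; rewrite mulnC; apply: divnK.
  rewrite dvdn2 oddM pE; have [nodd|neven] := boolP (odd n); last first.
    by rewrite oddB; [rewrite (negPf neven)|lia].
  rewrite negb_and; apply/orP; right; rewrite -addnBA; last by lia.
  by rewrite oddD oddM !oddB ?nodd ?andbF //; lia.
have : (n - 2) * 14 <= (n - 2) * p.
  rewrite leq_mul2l; apply/orP; right; rewrite pE; case: (k) k0 => // k' _.
  by rewrite (mulSn k'); move: (k' * _) n15; clear; lia.
rewrite /X -mulnA EE; move: n15; clear => n15 le [|[_]]; lia.
Qed.

(* 2 * ex(p; T_n^3) = (n-2)p - 6(n-7) + 2 * max{floor((n-37)/4), 0};
   the nat expression (n - 37) %/ 4 (truncated subtraction) equals
   max{floor((n-37)/4), 0}. *)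
Theorem theorem4p5 (p n k : nat) :
  15 <= n -> n <= p -> 0 < k -> p = k * (n - 1) + n - 7 ->
  2 * ex p (T3 n) = (n - 2) * p - 6 * (n - 7) + 2 * ((n - 37) %/ 4).
Proof.
move=> n15 _ k0 pE; apply/eqP.
by rewrite eqn_leq (ex_upper n15 k0 pE) (ex_lower n15 k0 pE).
Qed.
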